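(* Let $d\ge 1$ be an integer and let $y=\sum_{n\ge 1}s_d(n)x^n$ be the generating series (a formal power series in $x$) of the numbers $s_d(n)$ of decompositions of $(0,1)^d$ into $n$ regions obtainable by splitting operations. Then $y$ satisfies the functional equation $$x=\sum_{n\ge 1}\mu_d(n)\,y^n .$$
   Context: Write $[n]=\{1,\dots,n\}$. A region is an open box $R=(a_1,b_1)\times\cdots\times(a_d,b_d)\subseteq(0,1)^d$. For $i\in[d]$ and an integer $p\ge 2$, put $c_j=a_i+\frac{j}{p}(b_i-a_i)$ for $0\le j\le p$ and $H_{i,p}(R)=\{\{x\in R: c_{j-1}<x_i<c_j\}: j\in[p]\}$ (the $p$ equal pieces of $R$ cut orthogonally to axis $i$). The set $\mathcal S_d$ of decompositions of $(0,1)^d$ is defined recursively as the smallest set such that $\{(0,1)^d\}\in\mathcal S_d$, and whenever $S\in\mathcal S_d$, $R\in S$, $i\in[d]$, $p\ge2$, then $(S\setminus\{R\})\cup H_{i,p}(R)\in\mathcal S_d$ (a splitting operation). Let $\mathcal S_{d,n}=\{S\in\mathcal S_d:|S|=n\}$ and $s_d(n)=|\mathcal S_{d,n}|$ (decompositions are counted as sets of regions, so different splitting sequences giving the same set are counted once). Let $\mu$ be the classical Möbius function and $(\alpha\ast\beta)(n)=\sum_{i\mid n}\alpha(i)\beta(n/i)$ the Dirichlet convolution. Then $\mu_d=\mu\ast\mu\ast\cdots\ast\mu$ ($d$ factors). *)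

(* Defs.v *)
From mathcomp Require Import all_boot all_order all_algebra finmap.
From mathcomp Require Import all_classical all_reals.

Set Implicit Arguments.
Unset Strict Implicit.
Unset Printing Implicit Defensive.

Import Order.TTheory GRing.Theory Num.Theory.

Local Open Scope classical_set_scope.
Local Open Scope ring_scope.

(* Regions are sets of points of R^d and decompositions are sets of such sets,
   so that equality of decompositions is equality of sets of regions. *)

Definition box (R : realType) (d : nat) (a b : 'rV[R]_d) : set 'rV[R]_d :=
  [set x | forall i, a 0 i < x 0 i < b 0 i].

Definition cut (R : realType) (d : nat) (a b : 'rV[R]_d) (i : 'I_d)
    (p j : nat) : R :=
  a 0 i + j%:R / p%:R * (b 0 i - a 0 i).

Definition pieces (R : realType) (d : nat) (a b : 'rV[R]_d) (i : 'I_d)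
    (p : nat) : set (set 'rV[R]_d) :=
  [set Q | exists2 j : nat, (1 <= j <= p)%N &
     Q = [set x | box a b x /\ cut a b i p j.-1 < x 0 i < cut a b i p j]].

(* For 0 < d every member of a decomposition is a nonempty box, hence determines
   the endpoints a and b in [decomposition_split]. *)
Inductive decomposition (R : realType) (d : nat) :
    set (set 'rV[R]_d) -> Prop :=
| decomposition_unit :
    decomposition [set box (const_mx 0) (const_mx 1)]
| decomposition_split (S : set (set 'rV[R]_d)) (a b : 'rV[R]_d) (i : 'I_d)
    (p : nat) :
    decomposition S -> S (box a b) -> (2 <= p)%N ->
    decomposition ((S `\ box a b) `|` pieces a b i p).

Definition decompositions (R : realType) (d n : nat) :
    set (set (set 'rV[R]_d)) :=
  [set S | decomposition S /\ (S #= `I_n)%card].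

(* [fset_set] is the empty set on infinite sets; this default is not reached
   for 0 < d: a split into p pieces adds p - 1 >= 1 regions, so only finitely
   many decompositions have n regions. *)
Definition num_decompositions (R : realType) (d n : nat) : nat :=
  #|` fset_set (@decompositions R d n)|.

Definition moebius (n : nat) : int :=
  if (0 < n)%N && all (fun p => logn p n == 1%N) (primes n)
  then (-1) ^+ size (primes n) else 0.

Definition dirichlet (f g : nat -> int) (n : nat) : int :=
  \sum_(i <- divisors n) f i * g (n %/ i)%N.

(* The convolution of d copies of [moebius], for 0 < d. *)
Definition moebius_iter (d : nat) : nat -> int :=
  iter d.-1 (dirichlet moebius) moebius.

(* Formal power series over int, as coefficient sequences. *)
Definition fps := nat -> int.

Definition fps_one : fps := fun k => (k == 0%N)%:R.

Definition fps_X : fps := fun k => (k == 1%N)%:R.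

Definition fps_mul (f g : fps) : fps :=
  fun k => \sum_(i < k.+1) f i * g (k - i)%N.

Definition fps_exp (f : fps) (n : nat) : fps := iter n (fps_mul f) fps_one.

Definition fps_scale (c : int) (f : fps) : fps := fun k => c * f k.

(* The series F 1 + F 2 + ... converges to s in the X-adic topology. *)
Definition fps_has_sum (F : nat -> fps) (s : fps) : Prop :=
  forall k, exists N, forall M, (N <= M)%N ->
    \sum_(1 <= n < M) F n k = s k.

Definition decomposition_series (R : realType) (d : nat) : fps :=
  fun n => if n == 0%N then 0 else (num_decompositions R d n)%:Z.

(* Main.v *)
(* For a decomposition S and an axis i, every region of S has width 1/m along i
   for some integer m; let M_i(S) be the gcd of these m.  The key fact is that S
   can be obtained by first cutting the cube into p equal slabs along i if and
   only if p divides M_i(S).  Applying this one axis at a time, the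
   decompositions with m_i | M_i(S) for all i correspond to families of
   m_1 ... m_d decompositions, so their generating series is
   y^(m_1 ... m_d).  Summing against mu(m_1) ... mu(m_d) leaves, by Moebius
   inversion, only the S with all M_i(S) = 1, i.e. the undivided cube, whose
   series is x. *)
Require Import Defs.
From mathcomp Require Import all_boot all_order all_algebra finmap.
From mathcomp Require Import all_classical all_reals.
From mathcomp Require Import zify ring lra.

Set Implicit Arguments.
Unset Strict Implicit.
Unset Printing Implicit Defensive.

Import Order.TTheory GRing.Theory Num.Theory.

Local Open Scope fset_scope.
Local Open Scope nat_scope.

(** The given definition splits regions bottom-up and so hides the first cut, whereas the key fact
    is proved by induction on first cuts. Hence the top-down predicate [guillotine], shown
    separately to describe the same sets. Integer codes replace real boxes, so that lying in a slab,
    equality of regions and the gcds become arithmetic on pairs. Explicit bounds are needed to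
    enumerate decompositions and to truncate sums: a cut into p slabs multiplies denominators by p
    but leaves at least p - 1 regions outside any given slab, so denominators in a decomposition
    with n regions stay below 2^n. The d-fold convolution is never expanded. Its factors are removed
    one axis at a time, which works because the counts depend on the m_i only through their
    product. *)

(* A region obtained by splitting is a product of intervals (k/m, (k+1)/m), one
   for each axis; its code lists the pairs (k, m). *)
Notation code d := {ffun 'I_d -> nat * nat}.

(** * Arithmetic of codes *)

Definition code_unit (d : nat) : code d := [ffun=> (0, 1)].

(* The code of the image of the region [c'] under the axis-parallel affine map
   sending the unit cube onto the region [c]. *)
Definition code_mul (d : nat) (c c' : code d) : code d :=
  [ffun u => ((c u).1 * (c' u).2 + (c' u).1, (c u).2 * (c' u).2)].

Definition code_slice (d : nat) (i : 'I_d) (p j : nat) : code d :=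
  [ffun u => if u == i then (j, p) else (0, 1)].

Definition code_wf (d : nat) (c : code d) := forall u, (c u).1 < (c u).2.

Lemma code_mulA d (a b c : code d) :
  code_mul a (code_mul b c) = code_mul (code_mul a b) c.
Proof. by apply/ffunP => u; rewrite !ffunE /=; congr pair; lia. Qed.

Lemma code_mul1 d (c : code d) : code_mul (code_unit d) c = c.
Proof.
by apply/ffunP => u; rewrite !ffunE /=; case: (c u) => k m /=; congr pair; lia.
Qed.

Lemma code_mulr1 d (c : code d) : code_mul c (code_unit d) = c.
Proof.
by apply/ffunP => u; rewrite !ffunE /=; case: (c u) => k m /=; congr pair; lia.
Qed.

Lemma code_unit_wf d : code_wf (code_unit d).
Proof. by move=> u; rewrite ffunE. Qed.

Lemma code_slice_wf d (i : 'I_d) p j : j < p -> code_wf (code_slice i p j).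
Proof. by move=> jp u; rewrite ffunE; case: eqP. Qed.

Lemma code_mul_wf d (c c' : code d) :
  code_wf c -> code_wf c' -> code_wf (code_mul c c').
Proof. by move=> cw cw' u; rewrite !ffunE /=; move: (cw u) (cw' u); nia. Qed.

Lemma code_mul_inj d (c : code d) : code_wf c -> injective (code_mul c).
Proof.
move=> cw x y /ffunP E; apply/ffunP => u; have := E u; have := cw u.
rewrite !ffunE; case: (x u) (y u) (c u) => [k m] [k' m'] [a b] /= ab [].
move=> E1 E2; have E3 : m = m' by nia.
by congr pair => //; nia.
Qed.

(** Equal denominators on axis [i] give a common m, and then j * m + k = j' * m + k' with k, k' < m:
    the slab index is the quotient of the numerator by m. *)
Lemma code_slice_inj d (i : 'I_d) p j j' (x y : code d) :
  0 < p -> code_wf x -> code_wf y ->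
  code_mul (code_slice i p j) x = code_mul (code_slice i p j') y -> j = j'.
Proof.
move=> p0 xw yw /ffunP /(_ i); rewrite !ffunE eqxx /= => -[].
move: (xw i) (yw i); case: (x i) (y i) => [k m] [k' m'] /= km km' E1 E2.
have E3 : m = m' by nia.
by subst m'; nia.
Qed.

Lemma code_sliceC d (i i' : 'I_d) p j p' j' : i != i' ->
  code_mul (code_slice i p j) (code_slice i' p' j') =
  code_mul (code_slice i' p' j') (code_slice i p j).
Proof.
move=> ii'; apply/ffunP => u; rewrite !ffunE /=.
case: (eqVneq u i) => [->|]; first by rewrite (negbTE ii') /=; congr pair; lia.
by case: eqP => _ _ /=; congr pair; lia.
Qed.

Lemma code_sliceM d (i : 'I_d) p j q a :
  code_mul (code_slice i p j) (code_slice i q a) =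
  code_slice i (p * q) (j * q + a).
Proof. by apply/ffunP => u; rewrite !ffunE /=; case: eqP. Qed.

(** * Gluing decompositions of slabs *)

(** Only the values of [f] below [p] matter. Indexing by all of nat allows slabs to be regrouped
    through j * q + a without casts. *)
Definition glue d (i : 'I_d) (p : nat) (f : nat -> {fset code d}) :
    {fset code d} :=
  \bigcup_(j <- iota 0 p) [fset code_mul (code_slice i p j) c | c in f j].

Lemma glueP d (i : 'I_d) p f x :
  reflect (exists2 j, j < p &
             exists2 c, c \in f j & x = code_mul (code_slice i p j) c)
          (x \in glue i p f).
Proof.
apply: (iffP (bigfcupP _ _ _ _)) => [[j]|[j jp [c cf ->]]].
  rewrite mem_iota add0n andbT => jp /imfsetP [c /= cf ->].
  by exists j => //; exists c.
by exists j; [rewrite mem_iota jp | apply/imfsetP; exists c].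
Qed.

Lemma eq_glue d (i : 'I_d) p f g :
  (forall j, j < p -> f j = g j) -> glue i p f = glue i p g.
Proof.
move=> E; apply: eq_big_seq => j; rewrite mem_iota => jp.
by rewrite E.
Qed.

Lemma glue_glue d (i : 'I_d) p q f :
  glue i p (fun j => glue i q (fun a => f (j * q + a))) = glue i (p * q) f.
Proof.
apply/fsetP => x; apply/glueP/glueP.
  case=> j jp [_ /glueP [a aq [c cf ->]] ->].
  exists (j * q + a); first by nia.
  by exists c => //; rewrite code_mulA code_sliceM.
case=> j jpq [c cf ->].
have q0 : 0 < q by case: q jpq {cf} => //; rewrite muln0.
exists (j %/ q); first by rewrite ltn_divLR.
exists (code_mul (code_slice i q (j %% q)) c).
  apply/glueP; exists (j %% q); first by rewrite ltn_mod.
  by exists c => //; rewrite -divn_eq.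
by rewrite code_mulA code_sliceM -divn_eq.
Qed.

Lemma glueC d (i i' : 'I_d) p q f : i != i' ->
  glue i p (fun j => glue i' q (f j)) =
  glue i' q (fun a => glue i p (fun j => f j a)).
Proof.
move=> ii'; apply/fsetP => x; apply/glueP/glueP => -[j jp [_ /glueP [a aq [c cf ->]] ->]].
  exists a => //; exists (code_mul (code_slice i p j) c).
    by apply/glueP; exists j => //; exists c.
  by rewrite !code_mulA (code_sliceC _ _ _ _ ii').
exists a => //; exists (code_mul (code_slice i' q j) c).
  by apply/glueP; exists j => //; exists c.
by rewrite !code_mulA (code_sliceC _ _ _ _ ii').
Qed.

Lemma glue1 d (i : 'I_d) f : glue i 1 f = f 0.
Proof.
have E : code_slice i 1 0 = code_unit d.
  by apply/ffunP => u; rewrite !ffunE; case: eqP.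
apply/fsetP => x; apply/glueP/idP => [[[|//] _ [c cf ->]]|xf].
  by rewrite E code_mul1.
by exists 0 => //; exists x => //; rewrite E code_mul1.
Qed.

(** * Guillotine decompositions and their first cuts *)

(* The top-down description of decompositions: the first cut comes first. *)
Inductive guillotine (d : nat) : {fset code d} -> Prop :=
| guillotine_unit : guillotine [fset code_unit d]
| guillotine_glue (i : 'I_d) (p : nat) (f : nat -> {fset code d}) :
    1 < p -> (forall j, j < p -> guillotine (f j)) -> guillotine (glue i p f).

(** The degenerate cut p = 1 does occur when slabs are regrouped: below, [s] is 1 as soon as [r]
    divides [p]. *)
Lemma glue_guillotine d (i : 'I_d) p f :
  0 < p -> (forall j, j < p -> guillotine (f j)) -> guillotine (glue i p f).
Proof.
case: p => [//|[|p]] _ fg; last exact: guillotine_glue.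
by rewrite glue1; apply: fg.
Qed.

Lemma guillotine_wf d (S : {fset code d}) c :
  guillotine S -> c \in S -> code_wf c.
Proof.
move=> SG; elim: SG c => {S} [|i p f p1 fg IH] c.
  by rewrite inE => /eqP ->; apply: code_unit_wf.
case/glueP => j jp [c' cf ->].
by apply: code_mul_wf; [apply: code_slice_wf | apply: IH cf].
Qed.

Lemma guillotine_neq0 d (S : {fset code d}) : guillotine S -> exists c, c \in S.
Proof.
elim=> {S} [|i p f p1 fg IH]; first by exists (code_unit d); rewrite inE.
have p0 : 0 < p by lia.
have [c cf] := IH 0 p0.
by exists (code_mul (code_slice i p 0) c); apply/glueP; exists 0 => //; exists c.
Qed.

Lemma glue_dvdn d (i : 'I_d) p f c : c \in glue i p f -> p %| (c i).2.
Proof. by case/glueP => j jp [c' _ ->]; rewrite !ffunE eqxx /= dvdn_mulr. Qed.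

(* If the first cut of [S] is along another axis, it commutes with the cut into
   [p] slabs supplied by induction.  If it is along [i], into [r] slabs, then
   each slab can first be cut into [p %/ gcdn p r], so [S] can first be cut into
   [lcmn p r], which is regrouped as [p] slabs. *)
Lemma guillotine_dvdn_glue d (S : {fset code d}) (i : 'I_d) p :
  guillotine S -> 0 < p -> (forall c, c \in S -> p %| (c i).2) ->
  exists2 f, forall j, j < p -> guillotine (f j) & S = glue i p f.
Proof.
move=> SG; elim: SG p => {S} [|i' r g r1 gG IH] p p0 pS.
  have := pS (code_unit d); rewrite inE eqxx => /(_ isT).
  rewrite ffunE dvdn1 => /eqP ->.
  by exists (fun=> [fset code_unit d]); [move=> *; apply: guillotine_unit|rewrite glue1].
have r0 : 0 < r by lia.
have [E|ii'] := eqVneq i' i.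
  move: pS; rewrite E {i' E} => pS.
  pose h := gcdn p r; have h0 : 0 < h by rewrite gcdn_gt0 p0.
  pose q := p %/ h; pose s := r %/ h.
  have Ep : p = q * h by rewrite /q divnK ?dvdn_gcdl.
  have Er : r = s * h by rewrite /s divnK ?dvdn_gcdr.
  have q0 : 0 < q by nia.
  have s0 : 0 < s by nia.
  have cqs : coprime q s.
    by rewrite /coprime -(eqn_pmul2r h0) muln_gcdl -Ep -Er mul1n.
  (* The bound on [j] stands under the existential so that choice applies to all of nat; beyond [r]
     the family is arbitrary. *)
  have IHj j : exists f, j < r ->
      (forall a, a < q -> guillotine (f a)) /\ g j = glue i q f.
    have [jr|] := ltnP j r; last by exists (fun=> fset0).
    have [c cg|f fG gE] := IH j jr q q0; last by exists f.
    (* q * h divides s * h * (c i).2; cancelling h and using that q and s are coprime leaves q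
       dividing (c i).2. *)
    have : p %| (code_mul (code_slice i r j) c i).2.
      by apply: pS; apply/glueP; exists j => //; exists c.
    by rewrite !ffunE eqxx /= Ep {1}Er mulnAC dvdn_pmul2r // Gauss_dvdr.
  have {IHj} [F FP] := boolp.choice IHj.
  (* [G] lists the r * q = lcm(p, r) thin slabs in order; since r * q = p * s, consecutive blocks of
     [s] of them form the [p] slabs. *)
  pose G n := F (n %/ q) (n %% q).
  have GE j a : a < q -> G (j * q + a) = F j a.
    by move=> aq; rewrite /G divnMDl // divn_small // addn0 modnMDl modn_small.
  exists (fun a => glue i s (fun b => G (a * s + b))).
    move=> a ap; apply: glue_guillotine => // b bs.
    apply: (FP _ _).1; last by rewrite ltn_mod.
    by rewrite ltn_divLR //; nia.
  rewrite glue_glue.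
  have -> : p * s = r * q by nia.
  rewrite -glue_glue; apply: eq_glue => j jr.
  by rewrite (FP j jr).2; apply: eq_glue => a aq; rewrite GE.
have IHj j : exists f, j < r ->
    (forall a, a < p -> guillotine (f a)) /\ g j = glue i p f.
  have [jr|] := ltnP j r; last by exists (fun=> fset0).
  have [c cg|f fG gE] := IH j jr p p0; last by exists f.
  have : p %| (code_mul (code_slice i' r j) c i).2.
    by apply: pS; apply/glueP; exists j => //; exists c.
  by rewrite !ffunE eq_sym (negbTE ii') /= mul1n.
have {IHj} [F FP] := boolp.choice IHj.
exists (fun a => glue i' r (fun j => F j a)).
  by move=> a ap; apply: glue_guillotine => // j jr; apply: (FP j jr).1.
by rewrite -glueC //; apply: eq_glue => j /FP [].
Qed.

(** By [code_slice_inj] a code remembers its slab, so the contents of each slab can be recovered.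
    This makes gluing a bijection in the count below. *)
Lemma glue_inj d (i : 'I_d) p f g j :
  (forall j, j < p -> guillotine (f j)) ->
  (forall j, j < p -> guillotine (g j)) ->
  glue i p f = glue i p g -> j < p -> f j = g j.
Proof.
move=> fG gG E jp; have p0 : 0 < p by lia.
suff H f' g' : (forall j, j < p -> guillotine (f' j)) ->
    (forall j, j < p -> guillotine (g' j)) -> 
    glue i p f' = glue i p g' -> f' j `<=` g' j.
  by apply/eqP; rewrite eqEfsubset !H.
move=> {E} fG' gG' E; apply/fsubsetP => c cf.
have : code_mul (code_slice i p j) c \in glue i p g'.
  by rewrite -E; apply/glueP; exists j => //; exists c.
case/glueP => j' j'p [c' cg E'].
have cw := guillotine_wf (fG' j jp) cf.
have cw' := guillotine_wf (gG' j' j'p) cg.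
have jj := code_slice_inj p0 cw cw' E'; subst j'.
by rewrite (code_mul_inj (code_slice_wf i jp) E').
Qed.

Lemma card_glue d (i : 'I_d) p f : (forall j, j < p -> guillotine (f j)) ->
  #|` glue i p f| = \sum_(j < p) #|` f j|.
Proof.
move=> fG; rewrite /glue -(big_mkord xpredT (fun j => #|` f j|)) /index_iota subn0.
(* The induction runs over sublists of [iota 0 p]; the inclusion keeps their indices below [p]. *)
have : {subset iota 0 p <= iota 0 p} by [].
have : uniq (iota 0 p) by apply: iota_uniq.
elim: {1 2 4 5}(iota 0 p) => [|j s IH] /= => [_ _|/andP [js us] sp].
  by rewrite !big_nil cardfs0.
have jp : j < p by have := sp j; rewrite inE eqxx mem_iota; apply.
rewrite !big_cons /= -IH // => [|a /= as_]; last by apply: sp; rewrite inE as_ orbT.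
rewrite cardfsU [X in _ - X](_ : _ = 0) ?subn0.
  by congr addn; rewrite card_imfset //; apply/code_mul_inj/code_slice_wf.
apply/eqP; rewrite cardfs_eq0; apply/eqP/fsetP => x; rewrite !inE.
apply/negP => /andP [/imfsetP [c /= cf ->]] /bigfcupP [j' /andP [j's _]].
case/imfsetP => c' /= cf' E.
have j'p : j' < p.
  by have := sp j'; rewrite inE j's orbT mem_iota; apply.
have jj : j = j'.
  apply: code_slice_inj E; [by lia|exact: guillotine_wf (fG _ _) cf|].
  exact: guillotine_wf (fG _ _) cf'.
by rewrite jj j's in js.
Qed.

Lemma guillotine_card_gt0 d (S : {fset code d}) : guillotine S -> 0 < #|` S|.
Proof. by move=> /guillotine_neq0 [c cS]; rewrite cardfs_gt0; apply/fset0Pn; exists c. Qed.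

(** A first cut multiplies the denominator by at most p, while the other p - 1 slabs contribute at
    least p - 1 regions, and p <= 2^(p - 1). *)
Lemma guillotine_bound d (S : {fset code d}) c i :
  guillotine S -> c \in S -> (c i).2 < 2 ^ #|` S|.
Proof.
move=> SG; elim: SG c => {S} [|i' p f p1 fG IH] c.
  by rewrite inE => /eqP ->; rewrite ffunE cardfs1.
case/glueP => j jp [c' cf ->]; rewrite !ffunE.
have {IH} := IH j jp c' cf; rewrite card_glue // (bigD1 (Ordinal jp)) //=.
set T := \sum_(_ < _ | _) _.
have HT : p.-1 <= T.
  rewrite -[p.-1]mul1n -[p in p.-1]card_ord -(cardC1 (Ordinal jp)) -sum1_card mul1n.
  by apply: leq_sum => k _; apply/guillotine_card_gt0/fG.
have : p <= 2 ^ T.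
  have : p.-1 < 2 ^ p.-1 by apply: ltn_expl.
  have : 2 ^ p.-1 <= 2 ^ T by rewrite leq_pexp2l.
  by lia.
by case: eqP => _; rewrite expnD /=; nia.
Qed.

(** * Finite enumeration by number of regions *)

Definition code_bounded d (n : nat) : {fset code d} :=
  [fset [ffun u => (nat_of_ord (x u).1, nat_of_ord (x u).2)]
     | x : {ffun 'I_d -> 'I_n * 'I_n} in predT].

Lemma code_boundedP d n (c : code d) :
  (forall u, (c u).1 < n /\ (c u).2 < n) -> c \in code_bounded d n.
Proof.
move=> H; apply/imfsetP => /=.
exists [ffun u => (Ordinal (H u).1, Ordinal (H u).2)] => //.
by apply/ffunP => u; rewrite !ffunE /=; case: (c u).
Qed.

(** Numerators are below denominators, which [guillotine_bound] keeps below 2^n, so searching the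
    subsets of this finite set of codes misses nothing. *)
Definition guillotines d (n : nat) : seq {fset code d} :=
  [seq S : {fset code d} <- fpowerset (code_bounded d (2 ^ n))
     | `[< guillotine S >] && (#|` S| == n)].

Lemma guillotinesP d n (S : {fset code d}) :
  reflect (guillotine S /\ #|` S| = n) (S \in guillotines d n).
Proof.
rewrite mem_filter; apply: (iffP idP) => [/andP [/andP [/asboolP SG /eqP SE] _] //|].
case=> SG SE; rewrite SE eqxx andbT; apply/andP; split; first exact/asboolP.
rewrite fpowersetE; apply/fsubsetP => c cS; apply: code_boundedP => u.
have := guillotine_wf SG cS u; have := guillotine_bound u SG cS.
by rewrite SE => mn km; split=> //; apply: ltn_trans km mn.
Qed.

Lemma guillotines_uniq d n : uniq (guillotines d n).
Proof. by rewrite filter_uniq ?fset_uniq. Qed.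

Lemma guillotines0 d : guillotines d 0 = [::].
Proof.
case E: (guillotines _ _) => [//|S s].
have /guillotinesP [/guillotine_card_gt0] : S \in guillotines d 0.
  by rewrite E inE eqxx.
by case: #|` _|.
Qed.

Definition upto (T : Type) (e : nat -> seq T) (k : nat) : seq T :=
  [seq x | i <- iota 0 k.+1, x <- e i].

Lemma uptoP (T : eqType) (e : nat -> seq T) k x :
  reflect (exists2 i, i <= k & x \in e i) (x \in upto e k).
Proof.
apply: (iffP flatten_mapP) => -[i ik xe]; exists i.
- by rewrite mem_iota in ik; lia.
- by rewrite map_id in xe.
- by rewrite mem_iota; lia.
- by rewrite map_id.
Qed.

(** * Counting *)

(** When [e n] lists the items of weight n, these are the families counted by the coefficient of x^k
    in the p-th power of the generating series of [e]. *)
Fixpoint weighted_seqs (T : Type) (wt : T -> nat) (e : nat -> seq T)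
    (p k : nat) : seq (seq T) :=
  if p is p'.+1 then
    [seq x :: t | x <- upto e k,
                  t <- weighted_seqs wt e p' (k - wt x)]
  else if k == 0 then [:: [::]] else [::].

Lemma weighted_seqsP (T : eqType) (wt : T -> nat) (e : nat -> seq T) p k t :
  (forall n x, x \in e n -> wt x = n) ->
  reflect [/\ size t = p, forall x, x \in t -> x \in e (wt x)
             & \sum_(x <- t) wt x = k]
          (t \in weighted_seqs wt e p k).
Proof.
move=> ewt; apply: (iffP idP).
  elim: p k t => [|p IH] k t /=.
    by case: eqP => // ->; rewrite inE => /eqP ->; rewrite big_nil.
  case/allpairsPdep => x [s [/uptoP [i ik xe] sin ->]].
  have xi := ewt _ _ xe.
  have [<- st sk] := IH _ _ sin; split=> //.
    by move=> y; rewrite inE => /orP [/eqP ->|/st //]; rewrite xi.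
  by rewrite big_cons sk; lia.
elim: p k t => [|p IH] k [|x t] //= [] //; first by move=> _ _; rewrite big_nil => <-.
move=> [st] te; rewrite big_cons => tk; apply/allpairsPdep.
exists x, t; split=> //.
  by apply/uptoP; exists (wt x); [lia | apply: te; rewrite inE eqxx].
by apply: IH; split=> //; [move=> y yt; apply: te; rewrite inE yt orbT|lia].
Qed.

Lemma weighted_seqs_uniq (T : eqType) (wt : T -> nat) (e : nat -> seq T) p k :
  (forall n x, x \in e n -> wt x = n) -> (forall n, uniq (e n)) ->
  uniq (weighted_seqs wt e p k).
Proof.
move=> ewt ue; elim: p k => [|p IH] k /=; first by case: eqP.
apply: allpairs_uniq_dep => [|x _|[x s] [y t] _ _ /= [-> ->]] //.
apply: allpairs_uniq_dep => [||]; [exact: iota_uniq|by []|].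
move=> [i x] [j y] /allpairsPdep [i' [x' [_ xe [-> ->]]]].
move=> /allpairsPdep [j' [y' [_ ye [-> ->]]]] /= E; subst y'.
by rewrite -(ewt _ _ xe) -(ewt _ _ ye).
Qed.

Lemma size_weighted_seqs (T : eqType) (wt : T -> nat) (e : nat -> seq T) p k :
  (forall n x, x \in e n -> wt x = n) ->
  Posz (size (weighted_seqs wt e p k)) = fps_exp (fun n => Posz (size (e n))) p k.
Proof.
move=> ewt; elim: p k => [|p IH] k /=; first by rewrite /fps_one; case: eqP.
rewrite [RHS]/fps_mul /upto size_allpairs_dep map_flatten sumn_flatten -!map_comp.
rewrite sumnE big_map -[iota _ _]/(index_iota 0 k.+1) big_mkord.
rewrite (big_morph Posz PoszD (erefl _)).
apply: eq_bigr => i _ /=; rewrite map_id -IH -PoszM; congr Posz.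
(* All items of [e i] have weight [i], so each is followed by the same number of tails. *)
have : {subset e i <= e i} by [].
elim: {1 3 4}(e i) => [|x s IHs] /= sub; first by rewrite mul0n.
rewrite mulSn IHs => [|y ys]; last by apply: sub; rewrite inE ys orbT.
by rewrite (ewt i) // sub // inE eqxx.
Qed.

Definition refined d (m : 'I_d -> nat) (S : {fset code d}) : bool :=
  [forall i, all (fun c : code d => m i %| (c i).2) S].

Lemma refinedP d (m : 'I_d -> nat) (S : {fset code d}) :
  reflect (forall c, c \in S -> forall i, m i %| (c i).2) (refined m S).
Proof.
apply: (iffP forallP) => [H c cS i|H i]; first exact: (allP (H i)).
by apply/allP => c cS; apply: H.
Qed.

Definition refined_guillotines d (m : 'I_d -> nat) (n : nat) :=
  [seq S <- guillotines d n | refined m S].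

Lemma refined_guillotinesP d (m : 'I_d -> nat) n S :
  reflect [/\ guillotine S, #|` S| = n & refined m S]
          (S \in refined_guillotines m n).
Proof.
rewrite mem_filter andbC.
by apply: (iffP andP) => [[/guillotinesP [] //]|[SG Sn Sm]]; split=> //; apply/guillotinesP.
Qed.

(** Gluing is a bijection from families of [p] decompositions refined by [m], weighted by their
    total number of regions. As [m i] is 1, the slabs are unconstrained along [i], and scaling along
    [i] leaves the other denominators unchanged. *)
Lemma size_refined_guillotines_slice d (m : 'I_d -> nat) (i : 'I_d) p k :
  m i = 1 -> 0 < p ->
  Posz (size (refined_guillotines (fun u => if u == i then p else m u) k)) =
  fps_exp (fun n => Posz (size (refined_guillotines m n))) p k.
Proof.
move=> mi p0; set m' := (X in refined_guillotines X k).
pose wt (S : {fset code d}) := #|` S|.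
have ewt n x : x \in refined_guillotines m n -> wt x = n.
  by case/refined_guillotinesP.
have eu m0 n : uniq (@refined_guillotines d m0 n).
  by rewrite filter_uniq ?guillotines_uniq.
rewrite -(size_weighted_seqs p k ewt); congr Posz.
pose G (t : seq {fset code d}) := glue i p (fun j => nth fset0 t j).
set W := weighted_seqs _ _ _ _.
have WP t : t \in W -> [/\ size t = p, forall j, j < p -> guillotine (nth fset0 t j),
   forall j, j < p -> refined m (nth fset0 t j) & \sum_(x <- t) wt x = k].
  case/(weighted_seqsP _ _ _ ewt) => st te tk.
  have tj j : j < p -> nth fset0 t j \in refined_guillotines m (wt (nth fset0 t j)).
    by move=> jp; apply/te/mem_nth; rewrite st.
  by split=> // j jp; have /refined_guillotinesP [] := tj j jp.
have G_inj : {in W &, injective G}.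
  move=> t t' /WP [st tG _ _] /WP [st' tG' _ _] E.
  apply: (@eq_from_nth _ fset0) => [|j]; rewrite st ?st' // => jp.
  exact: glue_inj tG tG' E jp.
have mG f : (forall j, j < p -> refined m (f j)) -> refined m' (glue i p f).
  move=> fm; apply/refinedP => c cG u; rewrite /m'; case: eqP => [->|/eqP ui].
    exact: glue_dvdn cG.
  case/glueP: cG => j jp [c' cf ->]; rewrite !ffunE (negbTE ui) /= mul1n.
  exact: (refinedP _ _ (fm j jp)).
have card_G t : t \in W -> #|` G t| = k.
  case/WP => st tG _ <-; rewrite card_glue // (big_nth fset0) st big_mkord.
  by [].
rewrite -(size_map G); apply: perm_size; apply: uniq_perm; rewrite ?eu //.
  by rewrite map_inj_in_uniq // weighted_seqs_uniq.
move=> S; apply/refined_guillotinesP/mapP => [[SG Sk Sm]|[t tW ->]]; last first.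
  have [st tG tm _] := WP t tW.
  by split; [apply: glue_guillotine|apply: card_G|apply: mG].
have [c cS|f fG E] := guillotine_dvdn_glue (i := i) SG p0.
  by have /refinedP/(_ c cS i) := Sm; rewrite /m' eqxx.
have nthf j : j < p -> nth fset0 (mkseq f p) j = f j by move=> jp; rewrite nth_mkseq.
have SE : S = G (mkseq f p).
  by rewrite E; apply: eq_glue => j jp; rewrite nthf.
exists (mkseq f p) => //; apply/(weighted_seqsP _ _ _ ewt); split.
- by rewrite size_mkseq.
- move=> x /mapP [j]; rewrite mem_iota => /= jp ->.
  apply/refined_guillotinesP; split=> //; first exact: fG.
  apply/refinedP => c cf u; have [->|ui] := eqVneq u i; first by rewrite mi dvd1n.
  have /refinedP/(_ (code_mul (code_slice i p j) c)) := Sm.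
  rewrite /m' => /(_ _ u); rewrite !ffunE (negbTE ui) /= mul1n; apply.
  by rewrite E; apply/glueP; exists j => //; exists c.
- rewrite -Sk E card_glue // big_map -(big_mkord xpredT (fun j => #|` f j|)).
  by rewrite /index_iota subn0.
Qed.

Local Open Scope ring_scope.

(** * Powers of formal power series *)

(** Coefficients below [K] of a power involve only those of the base below [K]. Truncating to a
    polynomial thus transfers the exponent law from the polynomial ring. *)
Lemma coef_fps_exp (f : fps) (P : {poly int}) K n k :
  (forall i, (i < K)%N -> P`_i = f i) -> (k < K)%N ->
  (P ^+ n)`_k = fps_exp f n k.
Proof.
move=> Pf; elim: n k => [|n IH] k kK; first by rewrite expr0 coef1.
rewrite exprS coefM /=; apply: eq_bigr => i _.
by rewrite Pf ?IH //; case: i => i /=; lia.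
Qed.

Lemma fps_expM (f : fps) a b k :
  fps_exp (fps_exp f a) b k = fps_exp f (a * b) k.
Proof.
pose P : {poly int} := \poly_(i < k.+1) f i.
have PE i : (i < k.+1)%N -> P`_i = f i by move=> ik; rewrite coef_poly ik.
rewrite -(coef_fps_exp _ PE) // exprM; symmetry.
by apply: (@coef_fps_exp _ _ k.+1) => // i ik; apply: coef_fps_exp PE ik.
Qed.

Lemma fps_exp_lt (f : fps) n k : f 0%N = 0 -> (k < n)%N -> fps_exp f n k = 0.
Proof.
move=> f0; elim: n k => [//|n IH] k kn /=; apply: big1 => -[[|i] ik] _ /=.
  by rewrite f0 mul0r.
by rewrite IH ?mulr0 //; lia.
Qed.

Lemma fps_exp1 (f : fps) k : fps_exp f 1 k = f k.
Proof.
rewrite /= /fps_mul big_ord_recr /= subnn mulr1 big1 ?add0r // => i _.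
by rewrite /fps_one subn_eq0 leqNgt ltn_ord mulr0.
Qed.

(** The axes are imposed one at a time: [ms s] is 1 outside [s], so each new axis meets the
    hypothesis of the previous count, and the exponents multiply by [fps_expM]. *)
Lemma size_refined_guillotines d (m : 'I_d -> nat) k :
  (forall i, (0 < m i)%N) ->
  Posz (size (refined_guillotines m k)) =
  fps_exp (fun n => Posz (size (guillotines d n))) (\prod_i m i) k.
Proof.
move=> m0; pose ms (s : seq 'I_d) u := if u \in s then m u else 1%N.
have -> : m = ms (enum 'I_d) by apply/boolp.funext => u; rewrite /ms mem_enum.
have -> : (\prod_i ms (enum 'I_d) i = \prod_(i <- enum 'I_d) m i)%N.
  by rewrite big_enum; apply: eq_bigr => i _; rewrite /ms mem_enum.
elim: (enum 'I_d) (enum_uniq 'I_d) k => [_|i s IH /andP [/negbTE is_ us]] k.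
  rewrite big_nil fps_exp1 /refined_guillotines (eq_filter (a2 := predT)) ?filter_predT //.
  by move=> S; apply/refinedP => c _ u; apply: dvd1n.
have -> : ms (i :: s) = fun u => if u == i then m i else ms s u.
  by apply/boolp.funext => u; rewrite /ms inE; case: eqP => [->|].
rewrite size_refined_guillotines_slice ?/ms ?is_ //.
rewrite big_cons mulnC -fps_expM; congr (fps_exp _ _ _).
by apply/boolp.funext => n; apply: IH.
Qed.

(** * Moebius inversion *)

Lemma moebius_primeM p n : prime p -> (0 < n)%N -> ~~ (p %| n)%N ->
  moebius (p * n) = - moebius n.
Proof.
move=> pp n0 pn; have p0 := prime_gt0 pp.
have pnp : p \notin primes n by rewrite mem_primes (negbTE pn) !andbF.
have E : perm_eq (primes (p * n)) (p :: primes n).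
  apply: uniq_perm; rewrite /= ?primes_uniq ?pnp // => q.
  by rewrite primesM // primes_prime // !inE.
rewrite /moebius muln_gt0 p0 n0 /= (perm_size E) (perm_all _ E) /=.
have -> : logn p (p * n) = 1%N.
  by rewrite lognM // logn_prime // eqxx lognE (negbTE pn) !andbF.
rewrite eqxx /= (eq_in_all (a2 := fun q => logn q n == 1%N)).
  by case: ifP => _; rewrite ?oppr0 // exprS mulN1r.
move=> q qn; have qp : q != p by apply: contraNneq pnp => <-.
by rewrite lognM // logn_prime // (negbTE qp).
Qed.

Lemma moebius_sqr p n : prime p -> (p ^ 2 %| n)%N -> moebius n = 0.
Proof.
move=> pp pn; rewrite /moebius; case: ifP => // /andP [n0 /allP sqf].
have /eqP pn1 : logn p n == 1%N.
  by apply: sqf; rewrite mem_primes pp n0 (dvdn_trans _ pn) // dvdn_exp.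
by move: pn; rewrite pfactor_dvdn // pn1.
Qed.

(* For a prime [p] dividing [n], the divisors prime to [p] cancel against those
   divisible by [p] exactly once. *)
Lemma sum_moebius_divisors n : (0 < n)%N ->
  \sum_(a <- divisors n) moebius a = (n == 1%N)%:R.
Proof.
move=> n0; have [->|n1] := eqVneq n 1%N; first by rewrite big_seq1.
pose p := pdiv n; have pp : prime p by rewrite pdiv_prime //; lia.
have pn : (p %| n)%N by apply: pdiv_dvd.
have p0 := prime_gt0 pp.
rewrite (bigID (fun a => p %| a)%N) /=.
rewrite (bigID (fun a => p ^ 2 %| a)%N) /= big1 ?add0r; last first.
  by move=> a /andP [_ /moebius_sqr]; apply.
rewrite -big_filter -[X in _ + X]big_filter.
set D := [seq a <- divisors n | ~~ (p %| a)%N].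
have DP a : a \in D = ~~ (p %| a)%N && (a %| n)%N by rewrite mem_filter -dvdn_divisors.
rewrite (perm_big [seq (p * a)%N | a <- D]) /=.
  rewrite big_map -big_split big1_seq //= => a; rewrite DP => /andP [pa an].
  by rewrite moebius_primeM ?addNr // (dvdn_gt0 n0 an).
apply: uniq_perm => [||a].
- by rewrite filter_uniq ?divisors_uniq.
- rewrite map_inj_uniq ?filter_uniq ?divisors_uniq // => a b /eqP.
  by rewrite eqn_pmul2l // => /eqP.
rewrite mem_filter -dvdn_divisors //; apply/idP/mapP.
  case/andP => /andP [/dvdnP [b ->]]; rewrite mulnC expnS expn1 dvdn_pmul2l // => pb bn.
  by exists b => //; rewrite DP pb (dvdn_trans _ bn) // dvdn_mull.
case=> b; rewrite DP => /andP [pb bn] ->.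
rewrite expnS expn1 dvdn_pmul2l // pb dvdn_mulr //=.
by rewrite Gauss_dvd ?pn // prime_coprime.
Qed.

Lemma divisors_perm n N : (0 < n < N)%N ->
  perm_eq (divisors n) [seq a <- index_iota 1 N | (a %| n)%N].
Proof.
case/andP => n0 nN; apply: uniq_perm; rewrite ?divisors_uniq ?filter_uniq ?iota_uniq //.
move=> a; rewrite -dvdn_divisors // mem_filter mem_index_iota.
have [an|//] := boolP (a %| n)%N.
by rewrite (dvdn_gt0 n0 an) (leq_ltn_trans (dvdn_leq n0 an)).
Qed.

(** A summation range independent of [n] allows this sum to be exchanged with one over
    decompositions. *)
Lemma sum_moebius n N : (0 < n < N)%N ->
  \sum_(1 <= a < N) moebius a * (a %| n)%:R = (n == 1%N)%:R.
Proof.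
move=> nN; rewrite -sum_moebius_divisors; last by case/andP: nN.
rewrite (perm_big _ (divisors_perm nN)) big_filter [RHS]big_mkcond.
by apply: eq_bigr => a _; case: ifP; rewrite ?mulr1 ?mulr0.
Qed.

Lemma sum_nat_pred1 (F : nat -> int) x N : (0 < x)%N ->
  \sum_(1 <= n < N) (n == x)%:R * F n = if (x < N)%N then F x else 0.
Proof.
move=> x0; case: ifP => xN; last first.
  apply: big1_seq => n; rewrite mem_index_iota /= => /andP [_ nN].
  by case: eqP => [E|]; [lia|rewrite mul0r].
rewrite (bigD1_seq x) ?iota_uniq ?mem_index_iota ?x0 //= eqxx mul1r.
by rewrite big1 ?addr0 // => n /negbTE ->; rewrite mul0r.
Qed.

(** Both sides sum f a * g b * A (a * b) over pairs; the pairs with a * b >= N, present only on the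
    right, vanish by hypothesis. *)
Lemma sum_dirichlet (f g A : nat -> int) N :
  (forall n, (N <= n)%N -> A n = 0) ->
  \sum_(1 <= n < N) dirichlet f g n * A n =
  \sum_(1 <= a < N) f a * \sum_(1 <= b < N) g b * A (a * b)%N.
Proof.
move=> A0.
transitivity (\sum_(1 <= n < N) \sum_(1 <= a < N) \sum_(1 <= b < N)
    (n == (a * b)%N)%:R * (f a * g b * A n)).
  rewrite big_nat [RHS]big_nat; apply: eq_bigr => n nN.
  rewrite /dirichlet (perm_big _ (divisors_perm nN)) big_filter mulr_suml.
  rewrite big_mkcond big_nat [RHS]big_nat; apply: eq_bigr => a /andP [a0 aN].
  case: ifP => an; last first.
    rewrite big1 // => b _; case: eqP => [E|]; last by rewrite mul0r.
    by rewrite E dvdn_mulr in an.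
  rewrite [RHS](eq_bigr (fun b => (b == n %/ a)%N%:R * (f a * g b * A n))).
    case/andP: nN => n0 nN; rewrite sum_nat_pred1 ?divn_gt0 ?(dvdn_leq n0 an) //.
    by rewrite (leq_ltn_trans (leq_div _ _) nN).
  by move=> b _; rewrite eq_sym (eqn_div _ a0 an) mulnC.
rewrite exchange_big big_nat [RHS]big_nat; apply: eq_bigr => a /andP [a0 aN].
rewrite exchange_big mulr_sumr big_nat [RHS]big_nat; apply: eq_bigr => b /andP [b0 bN].
rewrite sum_nat_pred1 ?muln_gt0 ?a0 //.
by case: ltnP => [_|/A0 ->]; rewrite ?mulrA ?mulr0.
Qed.

Definition dirichlet_unit (n : nat) : int := (n == 1%N)%:R.

Lemma dirichlet_unitr f n : (0 < n)%N -> dirichlet f dirichlet_unit n = f n.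
Proof.
move=> n0; rewrite /dirichlet (bigD1_seq n) ?divisors_id ?divisors_uniq //=.
rewrite divnn n0 mulr1 big_seq_cond big1 ?addr0 // => a /andP [].
rewrite -dvdn_divisors // => an /negbTE na; rewrite /dirichlet_unit.
by rewrite eq_sym eqn_div ?mul1n ?(dvdn_gt0 n0 an) // na mulr0.
Qed.

(** Starting from the unit of the convolution lets the inversion below be an induction from d =
    0. *)
Lemma moebius_iterE d n : (0 < d)%N -> (0 < n)%N ->
  moebius_iter d n = iter d (dirichlet moebius) dirichlet_unit n.
Proof.
case: d => // d _; rewrite /moebius_iter /=; elim: d n => [|d IH] n n0.
  by rewrite /= dirichlet_unitr.
rewrite [LHS]/= [RHS]/= /dirichlet big_seq [RHS]big_seq; apply: eq_bigr => a.
rewrite -dvdn_divisors // => an.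
by rewrite IH // divn_gt0 ?(dvdn_leq n0 an) // (dvdn_gt0 n0 an).
Qed.

Lemma moebius_inversion d (T : eqType) (s : seq T) (w : T -> int)
    (M : T -> nat -> nat) (A : nat -> int) N :
  (forall x i, x \in s -> (0 < M x i < N)%N) ->
  (forall n, (N <= n)%N -> A n = 0) ->
  (forall m : nat -> nat, (forall i, 0 < m i)%N ->
     A (\prod_(i < d) m i)%N =
     \sum_(x <- s) w x * \prod_(i < d) (m i %| M x i)%:R) ->
  \sum_(1 <= n < N) iter d (dirichlet moebius) dirichlet_unit n * A n =
  \sum_(x <- s) w x * \prod_(i < d) (M x i == 1%N)%:R.
Proof.
move=> MN; elim: d w A => [|d IH] w A A0 AE /=.
  have := AE (fun=> 1%N) (fun=> isT); rewrite !big_ord0 => A1.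
  rewrite sum_nat_pred1 //; case: ltnP => [_|/A0 E].
    by rewrite A1; apply: eq_bigr => x _; rewrite !big_ord0.
  (* Here N <= 1: the left side is 0, and so is [A 1] by the vanishing hypothesis. *)
  by rewrite -[LHS]E A1; apply: eq_bigr => x _; rewrite !big_ord0.
rewrite sum_dirichlet //.
transitivity (\sum_(1 <= a < N) moebius a *
    \sum_(x <- s) w x * (a %| M x d)%:R * \prod_(i < d) (M x i == 1%N)%:R).
  rewrite big_nat [RHS]big_nat; apply: eq_bigr => a /andP [a0 aN]; congr (_ * _).
  apply: IH => [n nN|m m0]; first by apply: A0; rewrite (leq_trans nN) // leq_pmull.
  (* The hypothesis is used at [m] extended by [a] on the last axis. *)
  have := AE (fun i => if i == d then a else m i); rewrite big_ord_recr /= eqxx mulnC.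
  rewrite (eq_bigr (fun i : 'I_d => m i)); last first.
    by move=> i _; rewrite ltn_eqF // ltn_ord.
  move=> -> => [|i]; last by case: eqP.
  apply: eq_bigr => x _; rewrite big_ord_recr /= eqxx mulrAC mulrA.
  congr (_ * _ * _); apply: eq_bigr => i _; by rewrite ltn_eqF // ltn_ord.
rewrite (eq_bigr (fun a => \sum_(x <- s) (moebius a * (a %| M x d)%:R) *
   (w x * \prod_(i < d) (M x i == 1%N)%:R))); last first.
  move=> a _; rewrite mulr_sumr; apply: eq_bigr => x _.
  by rewrite -!mulrA; congr (_ * _); rewrite mulrCA.
rewrite exchange_big big_seq [RHS]big_seq; apply: eq_bigr => x xs.
by rewrite -mulr_suml sum_moebius ?MN // big_ord_recr /= mulrC mulrA.
Qed.

(** * The functional equation for guillotine decompositions *)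

Definition axis_gcd d (S : {fset code d}) (u : 'I_d) : nat :=
  \big[gcdn/0%N]_(c <- S) (c u).2.

Lemma dvdn_axis_gcd d (S : {fset code d}) u a :
  (a %| axis_gcd S u)%N = all (fun c : code d => a %| (c u).2)%N S.
Proof. by rewrite (big_morph _ (dvdn_gcd a) (dvdn0 a)) big_all. Qed.

(** A first cut into [p] slabs along [i] would make p > 1 divide the gcd along [i]. *)
Lemma guillotine_eq_unit d (S : {fset code d}) : guillotine S ->
  (forall u, axis_gcd S u = 1%N) -> S = [fset code_unit d].
Proof.
case=> // i p f p1 fG /(_ i) E; have : (p %| 1)%N.
  by rewrite -E dvdn_axis_gcd; apply/allP => c; apply: glue_dvdn.
by rewrite dvdn1; lia.
Qed.

Lemma guillotine_series d k : (0 < d)%N ->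
  exists N, forall M, (N <= M)%N ->
    \sum_(1 <= n < M)
      moebius_iter d n *
      fps_exp (fun n => Posz (size (guillotines d n))) n k = (k == 1%N)%:R.
Proof.
case: d => // d _; pose y n := Posz (size (guillotines d.+1 n)); rewrite -/y.
have y0 : y 0%N = 0 by rewrite /y guillotines0.
(* Beyond k the coefficient of x^k in y^n is 0, and 2^k exceeds every axis gcd of a decomposition
   with k regions. *)
exists (k.+1 + 2 ^ k)%N => N kN.
rewrite big_nat (eq_bigr (fun n => iter d.+1 (dirichlet moebius) dirichlet_unit n *
   fps_exp y n k)) => [|n /andP [n0 _]]; last by rewrite moebius_iterE.
rewrite -big_nat.
pose M (S : {fset code d.+1}) i := axis_gcd S (inord i).
rewrite (@moebius_inversion _ _ (guillotines d.+1 k) (fun=> 1) M); first last.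
- move=> m m0; have := @size_refined_guillotines d.+1 (fun i => m i) k (fun i => m0 i).
  move=> <-; rewrite size_filter -sum1_count (big_morph Posz PoszD (erefl _)).
  rewrite big_mkcond; apply: eq_bigr => S _; rewrite mul1r.
  have -> : refined (fun i : 'I_d.+1 => m i) S = [forall i : 'I_d.+1, m i %| M S i]%N.
    by apply: eq_forallb => i; rewrite /M inord_val dvdn_axis_gcd.
  case: ifP => [/forallP H|/negbT]; first by rewrite big1 // => i _; rewrite H.
  by rewrite negb_forall => /existsP [i /negbTE H]; rewrite (bigD1 i) //= H mul0r.
- by move=> n Nn; apply: fps_exp_lt => //; lia.
- move=> S i /guillotinesP [SG Sk].
  have [c cS] := guillotine_neq0 SG.
  have : (M S i %| (c (inord i)).2)%N.
    by have := dvdnn (M S i); rewrite {2}/M dvdn_axis_gcd => /allP; apply.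
  have cw := guillotine_wf SG cS (inord i).
  have cb := guillotine_bound (inord i) SG cS; rewrite Sk in cb.
  move=> H; have cp := leq_ltn_trans (leq0n _) cw.
  by rewrite (dvdn_gt0 cp H) /= (leq_ltn_trans (dvdn_leq cp H)) // (leq_trans cb) //; lia.
pose U := [fset code_unit d.+1].
have UM i : M U i = 1%N by rewrite /M /axis_gcd big_seq_fset1 ffunE.
have -> : \sum_(S <- guillotines d.+1 k) 1 * \prod_(i < d.+1) (M S i == 1%N)%:R =
    \sum_(S <- guillotines d.+1 k) (S == U)%:R :> int.
  rewrite big_seq [RHS]big_seq; apply: eq_bigr => S /guillotinesP [SG _].
  rewrite mul1r; case: eqP => [->|SU]; first by rewrite big1 // => i _; rewrite UM.
  have [i Mi] : exists i : 'I_d.+1, M S i != 1%N.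
    apply/existsP; rewrite -negb_forall; apply/negP => /forallP H; apply: SU.
    by apply: guillotine_eq_unit => // u; rewrite -(eqP (H u)) /M inord_val.
  by rewrite (bigD1 i) //= (negbTE Mi) mul0r.
have -> : (k == 1%N) = (U \in guillotines d.+1 k).
  apply/eqP/guillotinesP => [->|[_ <-]]; last by rewrite cardfs1.
  by split; [apply: guillotine_unit|rewrite cardfs1].
rewrite -(count_uniq_mem _ (guillotines_uniq _ _)) -sum1_count natr_sum [RHS]big_mkcond.
by apply: eq_bigr => S _ /=; case: eqP.
Qed.

Local Open Scope nat_scope.

(** * Bottom-up and top-down descriptions agree *)

Definition subdivide d (c : code d) (i : 'I_d) (p : nat) : {fset code d} :=
  [fset code_mul c (code_slice i p j) | j in iota 0 p].

Lemma subdivideP d (c : code d) i p x :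
  reflect (exists2 j, j < p & x = code_mul c (code_slice i p j))
          (x \in subdivide c i p).
Proof.
apply: (iffP (imfsetP _ _ _ _)) => /= -[j jp ->]; exists j => //.
  by rewrite mem_iota in jp.
by rewrite mem_iota.
Qed.

(* The bottom-up description, as in [decomposition], on codes. *)
Inductive reachable (d : nat) : {fset code d} -> Prop :=
| reachable_unit : reachable [fset code_unit d]
| reachable_split (S : {fset code d}) (c : code d) (i : 'I_d) (p : nat) :
    reachable S -> c \in S -> 1 < p ->
    reachable ((S `\ c) `|` subdivide c i p).

(** The region lies in one slab of the first cut, so the split is pushed into that slab; when the
    whole cube is reached, it becomes a first cut. *)
Lemma guillotine_split d (S : {fset code d}) c i p :
  guillotine S -> c \in S -> 1 < p -> guillotine ((S `\ c) `|` subdivide c i p).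
Proof.
move=> SG; elim: SG c => {S} [|i' q f q1 fG IH] c cS p1.
  have -> : [fset code_unit d] `\ c `|` subdivide c i p =
            glue i p (fun=> [fset code_unit d]); last first.
    by apply: guillotine_glue => // *; apply: guillotine_unit.
  rewrite inE in cS; rewrite (eqP cS) fsetDv fset0U.
  apply/fsetP => x; apply/subdivideP/glueP => -[j jp].
    move=> ->; exists j => //; exists (code_unit d); first by rewrite inE.
    by rewrite code_mul1 code_mulr1.
  case=> y; rewrite inE => /eqP -> ->; exists j => //.
  by rewrite code_mul1 code_mulr1.
case/glueP: cS => j0 j0q [c' cf Ec].
pose f' j := if j == j0 then f j `\ c' `|` subdivide c' i p else f j.
have -> : glue i' q f `\ c `|` subdivide c i p = glue i' q f'; last first.
  by apply: guillotine_glue => // j jq; rewrite /f'; case: eqP => [E|_];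
    [rewrite E; apply: IH | apply: fG].
have q0 : 0 < q by lia.
have cw' := guillotine_wf (fG _ j0q) cf.
apply/fsetP => x; rewrite in_fsetU in_fsetD1; apply/idP/glueP.
  case/orP => [/andP [xc /glueP [j jq [y yf E]]]|/subdivideP [j jp ->]].
    exists j => //; exists y => //; rewrite /f'; case: eqP => // jj.
    rewrite !inE yf andbT; apply/orP; left; apply: contra xc => /eqP yc.
    by rewrite E Ec jj yc.
  exists j0 => //; exists (code_mul c' (code_slice i p j)); last by rewrite Ec code_mulA.
  rewrite /f' eqxx in_fsetU; apply/orP; right; apply/subdivideP.
  by exists j.
case=> j jq [y]; rewrite /f'; have [->|jj] := eqVneq j j0.
  rewrite !inE => /orP [/andP [yc yf]|/subdivideP [a ap ->]] ->; last first.
    apply/orP; right; apply/subdivideP; exists a => //.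
    by rewrite Ec code_mulA.
  apply/orP; left; apply/andP; split; last by apply/glueP; exists j0 => //; exists y.
  by rewrite Ec; apply: contra yc => /eqP /(code_mul_inj (code_slice_wf _ j0q)) ->.
move=> yf ->; apply/orP; left; apply/andP; split; last first.
  by apply/glueP; exists j => //; exists y.
apply: contra jj => /eqP; rewrite Ec => E; apply/eqP.
exact: code_slice_inj q0 (guillotine_wf (fG _ jq) yf) cw' E.
Qed.

Lemma reachable_guillotine d (S : {fset code d}) : reachable S -> guillotine S.
Proof.
by elim=> {S} [|S c i p _ SG cS p1]; [apply: guillotine_unit|apply: guillotine_split].
Qed.

(** Disjointness in terms of codes: a common subregion forces equality. It places both regions in
    the same slab of the first cut, where induction applies. *)
Lemma guillotine_disjoint d (S : {fset code d}) c c' x y :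
  guillotine S -> c \in S -> c' \in S -> code_wf x -> code_wf y ->
  code_mul c x = code_mul c' y -> c = c'.
Proof.
move=> SG; elim: SG c c' => {S} [|i p f p1 fG IH] c c'.
  by rewrite !inE => /eqP -> /eqP ->.
case/glueP => j jp [a af ->] /glueP [j' j'p [a' af' ->]] xw yw.
have aw := guillotine_wf (fG _ jp) af.
have aw' := guillotine_wf (fG _ j'p) af'.
rewrite -!code_mulA => E.
have jj : j = j'.
  by apply: code_slice_inj E; [lia|apply: code_mul_wf|apply: code_mul_wf].
subst j'; congr code_mul.
by apply: (IH _ jp) xw yw _ => //; apply: code_mul_inj E; apply: code_slice_wf.
Qed.

(** Building [S] inside a region of an arbitrary reachable [T] is the form that induction needs:
    after the first cut the slabs are filled in turn, each in the presence of the others. *)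
Lemma reachable_graft d (S T : {fset code d}) c :
  guillotine S -> reachable T -> c \in T ->
  reachable ((T `\ c) `|` [fset code_mul c x | x in S]).
Proof.
move=> SG; elim: SG T c => {S} [|i p f p1 fG IH] T c TR cT.
  have -> : T `\ c `|` [fset code_mul c x | x in [fset code_unit d]] = T; last by [].
  apply/fsetP => x; rewrite !inE; case: eqVneq => [->|xc] /=.
    by rewrite cT; apply/imfsetP; exists (code_unit d); rewrite ?inE ?code_mulr1.
  case: (x \in T) => //=; apply/imfsetP => -[y /=]; rewrite inE => /eqP ->.
  by rewrite code_mulr1 => E; rewrite E eqxx in xc.
have TG := reachable_guillotine TR; have cw := guillotine_wf TG cT.
have p0 : 0 < p by lia.
(* [glue i p (g t)]: only the first [t] slabs have been subdivided further. *)
pose g t j := if j < t then f j else [fset code_unit d].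
have gG t j : j < p -> guillotine (g t j).
  by move=> jp; rewrite /g; case: ifP => _; [apply: fG|apply: guillotine_unit].
suff H t : t <= p -> reachable (T `\ c `|` [fset code_mul c x | x in glue i p (g t)]).
  have E : glue i p (g p) = glue i p f by apply: eq_glue => j jp; rewrite /g jp.
  by have := H p (leqnn p); rewrite E.
elim: t => [_|t IHt tp].
  have -> : [fset code_mul c x | x in glue i p (g 0)] = subdivide c i p; last first.
    exact: reachable_split.
  apply/fsetP => x; apply/imfsetP/subdivideP => /= [[y /glueP [j jp [z]]]|[j jp ->]].
    by rewrite inE => /eqP -> -> ->; exists j => //; rewrite code_mulr1.
  exists (code_slice i p j) => //; apply/glueP; exists j => //.
  by exists (code_unit d); rewrite ?inE ?code_mulr1.
have {IHt} := IHt (ltnW tp); set U := _ `|` _ => UR.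
pose ct := code_mul c (code_slice i p t).
have ctU : ct \in U.
  rewrite in_fsetU; apply/orP; right; apply/imfsetP; exists (code_slice i p t) => //=.
  apply/glueP; exists t => //; exists (code_unit d); last by rewrite code_mulr1.
  by rewrite /g ltnn inE.
have := IH t tp U ct UR ctU; congr (reachable _).
apply/fsetP => x; rewrite !in_fsetU !in_fsetD1; apply/idP/idP.
  case/orP => [/andP [xct]|].
    rewrite in_fsetU in_fsetD1 => /orP [->//|/imfsetP [y /= /glueP [j jp [z zg ->]] xE]].
    apply/orP; right; apply/imfsetP; exists (code_mul (code_slice i p j) z) => //=.
    apply/glueP; exists j => //; exists z => //; move: zg; rewrite /g.
    case: (ltngtP j t) => [jt|jt|jt]; rewrite ?(ltn_trans jt) //; try by rewrite ltnNge jt.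
    rewrite inE => /eqP zE; move: xct.
    by rewrite xE zE jt code_mulr1 eqxx.
  case/imfsetP => y /= yf ->; apply/orP; right; apply/imfsetP.
  exists (code_mul (code_slice i p t) y); last by rewrite code_mulA.
  by apply/glueP; exists t => //; exists y => //; rewrite /g ltnSn.
case/orP => [/andP [xc xT]|/imfsetP [y /= /glueP [j jp [z zg ->]] xE]].
  (* A region of [T] equal to [ct] would share a subregion with [c], hence be [c] itself. *)
  have xU : x \in U by rewrite in_fsetU in_fsetD1 xc xT.
  apply/orP; left; rewrite xU andbT.
  apply/eqP => E; move/eqP: xc; apply.
  apply: (@guillotine_disjoint _ _ _ _ (code_unit d) (code_slice i p t) TG) => //.
  - exact: code_unit_wf.
  - exact: code_slice_wf.
  - by rewrite code_mulr1.
have zw := guillotine_wf (gG _ _ jp) zg.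
have [jt|jt] := eqVneq j t.
  apply/orP; right; apply/imfsetP; exists z; last by rewrite xE jt code_mulA.
  by move: zg; rewrite /g jt ltnSn.
apply/orP; left; rewrite in_fsetU; apply/andP; split.
  apply: contra jt => /eqP; rewrite xE => /(code_mul_inj cw) E.
  apply/eqP; apply: (@code_slice_inj d i p j t z (code_unit d) p0 zw).
    exact: code_unit_wf.
  by rewrite code_mulr1.
apply/orP; right; apply/imfsetP; exists (code_mul (code_slice i p j) z) => //=.
apply/glueP; exists j => //; exists z => //; move: zg; rewrite /g ltnS leq_eqVlt.
by rewrite (negbTE jt).
Qed.

Lemma guillotine_reachable d (S : {fset code d}) : guillotine S -> reachable S.
Proof.
move=> SG; have := reachable_graft SG (reachable_unit d) (c := code_unit d).
rewrite inE eqxx fsetDv fset0U => /(_ isT); congr (reachable _).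
apply/fsetP => x; apply/imfsetP/idP => /= [[y yS ->]|xS]; first by rewrite code_mul1.
by exists x => //; rewrite code_mul1.
Qed.

Local Open Scope classical_set_scope.
Local Open Scope ring_scope.

(** * From codes to regions *)

Lemma box_mid (R : realType) d (a b : 'rV[R]_d) :
  (forall i, a 0 i < b 0 i) -> box a b (\row_i ((a 0 i + b 0 i) / 2)).
Proof. by move=> ab i; rewrite mxE; have := ab i; lra. Qed.

Lemma box_sub (R : realType) d (a b a' b' : 'rV[R]_d) :
  (forall i, a 0 i < b 0 i) -> box a b `<=` box a' b' ->
  forall i, a' 0 i <= a 0 i /\ b 0 i <= b' 0 i.
Proof.
move=> ab sub i; have abi := ab i.
have box_at t : a 0 i < t < b 0 i ->
    box a b (\row_u (if u == i then t else (a 0 u + b 0 u) / 2)).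
  by move=> t_i u; rewrite mxE; case: eqP => [->//|_]; have := ab u; lra.
have t_in t : a 0 i < t < b 0 i -> a' 0 i < t < b' 0 i.
  by move=> /box_at /sub /(_ i); rewrite mxE eqxx.
have := t_in ((a 0 i + b 0 i) / 2) ltac:(lra) => mid.
split; rewrite leNgt; apply/negP => lt.
  (* If a < a' on axis [i], this point lies in (a, b) but below a'; the minimum keeps it below b. *)
  have /t_in : a 0 i < (a 0 i + Num.min (a' 0 i) (b 0 i)) / 2 < b 0 i by case: (leP (a' 0 i) (b 0 i)) => ?; lra.
  by case: (leP (a' 0 i) (b 0 i)) => ?; lra.
have /t_in : a 0 i < (b 0 i + Num.max (b' 0 i) (a 0 i)) / 2 < b 0 i by case: (leP (b' 0 i) (a 0 i)) => ?; lra.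
by case: (leP (b' 0 i) (a 0 i)) => ?; lra.
Qed.

Lemma box_inj (R : realType) d (a b a' b' : 'rV[R]_d) :
  (forall i, a 0 i < b 0 i) -> box a b = box a' b' -> a = a' /\ b = b'.
Proof.
move=> ab E; have ab' i : a' 0 i < b' 0 i.
  have : box a' b' (\row_i ((a 0 i + b 0 i) / 2)) by rewrite -E; apply: box_mid.
  by move=> /(_ i) /andP [/lt_trans]; apply.
have sub i : [/\ a' 0 i <= a 0 i, b 0 i <= b' 0 i, a 0 i <= a' 0 i & b' 0 i <= b 0 i].
  have [|? ?] := box_sub ab (a' := a') (b' := b') _ i; first by rewrite E.
  by have [|? ?] := box_sub ab' (a' := a) (b' := b) _ i; first by rewrite E.
by split; apply/rowP => i; apply/eqP; rewrite eq_le; apply/andP; have [] := sub i.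
Qed.

Definition code_lo (R : realType) d (c : code d) : 'rV[R]_d :=
  \row_i ((c i).1%:R / (c i).2%:R).

Definition code_hi (R : realType) d (c : code d) : 'rV[R]_d :=
  \row_i ((c i).1.+1%:R / (c i).2%:R).

Definition region (R : realType) d (c : code d) : set 'rV[R]_d :=
  box (code_lo R c) (code_hi R c).
Arguments region R [d] c _.

Lemma code_lo_lt_hi (R : realType) d (c : code d) i :
  code_wf c -> code_lo R c 0 i < code_hi R c 0 i.
Proof.
move=> cw; rewrite !mxE ltr_pM2r ?ltr_nat // invr_gt0 ltr0n.
exact: leq_ltn_trans (cw i).
Qed.

(** Fractions need not be in lowest terms: the width 1/m determines m, and then the left end k/m
    determines k. *)
Lemma region_inj (R : realType) d (c c' : code d) :
  code_wf c -> code_wf c' -> region R c = region R c' -> c = c'.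
Proof.
move=> cw cw' /box_inj [i|/rowP lo /rowP hi]; first exact: code_lo_lt_hi.
apply/ffunP => i; have := lo i; have := hi i; rewrite !mxE.
have := cw i; have := cw' i; case: (c i) (c' i) => [k m] [k' m'] /= km' km.
have m0 : m%:R != 0 :> R by rewrite pnatr_eq0; lia.
have m0' : m'%:R != 0 :> R by rewrite pnatr_eq0; lia.
move=> /eqP; rewrite eqr_div // -!natrM eqr_nat => /eqP Ehi.
move=> /eqP; rewrite eqr_div // -!natrM eqr_nat => /eqP Elo.
have E : m = m' by nia.
by subst m'; congr pair; nia.
Qed.

Lemma region_unit (R : realType) d :
  region R (code_unit d) = box (const_mx 0) (const_mx 1).
Proof. by rewrite /region; congr box; apply/rowP => i; rewrite !mxE ffunE /= divr1. Qed.

Lemma region_slice (R : realType) d (c : code d) i p j :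
  code_wf c -> (j < p)%N ->
  region R (code_mul c (code_slice i p j)) =
  [set x | region R c x /\ cut (code_lo R c) (code_hi R c) i p j < x 0 i
                         < cut (code_lo R c) (code_hi R c) i p j.+1].
Proof.
move=> cw jp; have p0 : (p%:R : R) != 0 by rewrite pnatr_eq0; lia.
have m0 : ((c i).2%:R : R) != 0 by rewrite pnatr_eq0; have := cw i; lia.
have p1 : 0 < (p%:R : R) by rewrite ltr0n; lia.
have m1 : 0 < ((c i).2%:R : R) by rewrite ltr0n; have := cw i; lia.
pose C := code_mul c (code_slice i p j).
have lo_i : code_lo R C 0 i = cut (code_lo R c) (code_hi R c) i p j.
  by rewrite /cut !mxE !ffunE eqxx /= natrD !natrM -[in RHS]natr1; field; apply/andP.
have hi_i : code_hi R C 0 i = cut (code_lo R c) (code_hi R c) i p j.+1.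
  by rewrite /cut !mxE !ffunE eqxx /= -!natr1 natrD !natrM; field; apply/andP.
have lo_u u : u != i -> code_lo R C 0 u = code_lo R c 0 u.
  by move=> /negbTE ui; rewrite !mxE !ffunE ui /= !muln1 addn0.
have hi_u u : u != i -> code_hi R C 0 u = code_hi R c 0 u.
  by move=> /negbTE ui; rewrite !mxE !ffunE ui /= !muln1 addn0.
apply/seteqP; split => x /=.
  move=> xC; have xi := xC i; rewrite lo_i hi_i in xi; split=> // u.
  have [->|ui] := eqVneq u i; last by have := xC u; rewrite lo_u ?hi_u.
  case/andP: xi => xlo xhi; apply/andP; split.
    apply: le_lt_trans xlo; rewrite /cut lerDl mulr_ge0 ?divr_ge0 ?ler0n //.
    by rewrite subr_ge0 ltW // code_lo_lt_hi.
  apply: lt_le_trans xhi _; rewrite /cut -lerBrDl ler_piMl //.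
    by rewrite subr_ge0 ltW // code_lo_lt_hi.
  by rewrite ler_pdivrMr // mul1r ler_nat.
move=> [xc xi] u; have [->|ui] := eqVneq u i; first by rewrite lo_i hi_i.
by rewrite lo_u ?hi_u //; apply: xc.
Qed.

Definition regions (R : realType) d (F : {fset code d}) : set (set 'rV[R]_d) :=
  [set region R c | c in [set` F]].
Arguments regions R [d] F _.

Lemma regions_subdivide (R : realType) d (c : code d) i p :
  code_wf c ->
  regions R (subdivide c i p) = pieces (code_lo R c) (code_hi R c) i p.
Proof.
move=> cw; apply/seteqP; split => Q /=.
  (* Slabs are numbered from 0 in codes and from 1 in [pieces]. *)
  case=> x /= /subdivideP [j jp ->] <-; exists j.+1 => //.
  by rewrite region_slice.
case=> -[//|j] /= jp ->; exists (code_mul c (code_slice i p j)).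
  by apply/subdivideP; exists j.
by rewrite region_slice.
Qed.

Lemma regions_split (R : realType) d (F : {fset code d}) c i p :
  guillotine F -> c \in F ->
  regions R ((F `\ c) `|` subdivide c i p)%fset =
  (regions R F `\ region R c) `|` pieces (code_lo R c) (code_hi R c) i p.
Proof.
move=> FG cF; have cw := guillotine_wf FG cF.
rewrite -regions_subdivide //; apply/seteqP; split => Q.
  case=> x /=; rewrite in_fsetU in_fsetD1 => /orP [/andP [xc xF]|xs] <-.
    left; split; first by exists x.
    move=> /= E; move/eqP: xc; apply.
    exact: region_inj (guillotine_wf FG xF) cw E.
  by right; exists x.
case=> [[[x /= xF <-] xc]|[x /= xs <-]]; exists x => //=; rewrite in_fsetU in_fsetD1.
  by apply/orP; left; rewrite xF andbT; apply/eqP => E; apply: xc; rewrite E.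
by rewrite xs orbT.
Qed.

Lemma regions_unit (R : realType) d :
  regions R [fset code_unit d]%fset = [set box (const_mx 0) (const_mx 1)].
Proof.
rewrite -region_unit; apply/seteqP; split => Q.
  by case=> x /=; rewrite inE => /eqP -> <-.
by move=> /= ->; exists (code_unit d); rewrite //= inE.
Qed.

(** * Transfer to decompositions of the cube *)

Lemma decompositionP (R : realType) d (S : set (set 'rV[R]_d)) :
  decomposition S <-> exists2 F, guillotine F & S = regions R F.
Proof.
split.
  elim=> {S} [|S a b i p _ [F FG ->] [c /= cF cE] p1].
    by exists [fset code_unit d]%fset; [apply: guillotine_unit|rewrite regions_unit].
  exists ((F `\ c) `|` subdivide c i p)%fset; first exact: guillotine_split.
  have cw := guillotine_wf FG cF.
  have [|<- <-] := box_inj _ cE; first by move=> u; apply: code_lo_lt_hi.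
  by rewrite regions_split.
case=> F /guillotine_reachable FR ->.
elim: FR => {F} [|F c i p FR FD cF p1]; first by rewrite regions_unit; apply: decomposition_unit.
rewrite regions_split //; last exact: reachable_guillotine.
by apply: decomposition_split => //; exists c.
Qed.

Lemma card_regions (R : realType) d (F : {fset code d}) n :
  guillotine F -> (regions R F #= `I_n)%card <-> #|` F|%fset = n.
Proof.
move=> FG.
have E : (regions R F #= [set` F])%card.
  apply: inj_card_eq => x y; rewrite !inE /= => xF yF.
  by apply: region_inj; apply: guillotine_wf FG _.
split=> [H|<-]; last by apply: card_eq_trans E _; apply/card_eq_fsetP.
by apply/card_eq_fsetP; apply: card_eq_trans H; rewrite card_eq_sym.
Qed.

Lemma regions_inj (R : realType) d (F G : {fset code d}) :
  guillotine F -> guillotine G -> regions R F = regions R G -> F = G.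
Proof.
suff H (F' G' : {fset code d}) : guillotine F' -> guillotine G' ->
    regions R F' = regions R G' -> (F' `<=` G')%fset.
  by move=> FG GG E; apply/eqP; rewrite eqEfsubset !H.
move=> FG GG E; apply/fsubsetP => x xF.
have : regions R G' (region R x) by rewrite -E; exists x.
case=> y /= yG /region_inj xy.
by rewrite -xy //; [apply: guillotine_wf GG yG|apply: guillotine_wf FG xF].
Qed.

Lemma num_decompositionsE (R : realType) d n :
  num_decompositions R d n = size (guillotines d n).
Proof.
(* Exhibiting the decompositions as an explicit finite set keeps [fset_set] away from its default
   value. *)
pose X := [fset regions R F | F in guillotines d n]%fset.
have -> : num_decompositions R d n = #|` fset_set [set` X]|%fset.
  congr #|` fset_set _|%fset; apply/seteqP; split => S /=.
    case=> /decompositionP [F FG ->] /(card_regions _ _ FG) Fn.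
    by apply/imfsetP; exists F => //; apply/guillotinesP.
  case/imfsetP => F /= /guillotinesP [FG Fn] ->; split.
    by apply/decompositionP; exists F.
  exact/card_regions.
rewrite set_fsetK card_in_imfset /=; last first.
  by move=> F G /guillotinesP [FG _] /guillotinesP [GG _]; apply: regions_inj.
by rewrite undup_id ?guillotines_uniq.
Qed.

Theorem theorem2 (R : realType) (d : nat) (hd : (1 <= d)%N) :
  fps_has_sum
    (fun n => fps_scale (moebius_iter d n)
                (fps_exp (decomposition_series R d) n))
    fps_X.
Proof.
move=> k; have [N NP] := guillotine_series k hd; exists N => M /NP.
suff -> : decomposition_series R d = fun n => Posz (size (guillotines d n)) by [].
apply/boolp.funext => n; rewrite /decomposition_series num_decompositionsE.
by case: eqP => [->|]; rewrite ?guillotines0.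
Qed.
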